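(* Let $G$ be a graph with $n$ vertices, let $\alpha\in(1/2,1]$, and let $k$ be an integer with $2\leq k\leq n$. Then $\lambda_k(A_{\alpha}(G))= \alpha n-1$ if and only if $G$ has at least $k$ vertices of degree $n-1$.
   Context: All graphs are finite, simple and undirected. For a graph $G$ with adjacency matrix $A(G)$ and diagonal degree matrix $D(G)$, and a real $\alpha\in[0,1]$, $A_{\alpha}(G)=\alpha D(G)+(1-\alpha)A(G)$. Its eigenvalues are denoted $\lambda_1(A_\alpha(G))\geq\cdots\geq\lambda_n(A_\alpha(G))$. *)

(* Defs.v *)
From HB Require Import structures.
From mathcomp Require Import all_boot all_order all_algebra.
From mathcomp Require Import polyrcf complex.
From mathcomp Require Import reals.
Set Implicit Arguments.
Unset Strict Implicit.
Unset Printing Implicit Defensive.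
Import Order.TTheory GRing.Theory Num.Theory.
Local Open Scope ring_scope.
Local Open Scope complex_scope.

Record sgraph := SGraph {
  vertex :> finType;
  adj : rel vertex;
  adj_sym : symmetric adj;
  adj_irrefl : irreflexive adj
}.

Definition deg (G : sgraph) (v : G) : nat := #|[set w | adj v w]|.

(* Matrices of G are indexed by 'I_#|G|, through the enumeration enum_val of
   the vertices. *)
Definition adjmx (R : nzRingType) (G : sgraph) : 'M[R]_#|G| :=
  \matrix_(i, j) (adj (enum_val i) (enum_val j))%:R.

Definition degmx (R : nzRingType) (G : sgraph) : 'M[R]_#|G| :=
  diag_mx (\row_i (deg (enum_val i))%:R).

Definition Aalpha (R : nzRingType) (G : sgraph) (alpha : R) : 'M[R]_#|G| :=
  alpha *: degmx R G + (1 - alpha) *: adjmx R G.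

(* The real eigenvalues of A in nonincreasing order, each one repeated
   according to its algebraic multiplicity. For a symmetric A, there are
   exactly n of them: see char_poly_eigenvalues and size_eigenvalues. *)
Definition eigenvalues (R : rcfType) n (A : 'M[R]_n) : seq R :=
  sort >=%R (flatten [seq nseq (mup x (char_poly A)) x
                     | x <- rootsR (char_poly A)]).

(* The k-th largest eigenvalue, counted from k = 1. *)
Definition lambda (R : rcfType) n (k : nat) (A : 'M[R]_n) : R :=
  (eigenvalues A)`_k.-1.

Lemma symmetric_char_poly_split (R : rcfType) n (A : 'M[R]_n) : A^T = A ->
  exists s : seq R, char_poly A = \prod_(x <- s) ('X - x%:P).
Proof.
move=> symA; pose f : {rmorphism R -> R[i]} := real_complex R.
pose B := map_mx f A.
have hB : B \is hermsymmx.
  apply/is_hermitianmxP; rewrite expr0 scale1r /B map_trmx symA.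
  apply/matrixP => i j; rewrite !mxE /=.
  by apply/esym/CrealP/complex_realP; eexists.
have /mxOverP dR := hermitian_spectral_diag_real hB.
have /orthomx_spectralP := hermitian_normalmx hB.
set P := spectralmx B; set d := spectral_diag B in dR * => BE.
have uP : P \in unitmx by apply: spectral_unit.
pose s := [seq complex.Re (d 0 i) | i <- enum 'I_n].
exists s; apply: (map_poly_inj f).
rewrite (map_char_poly f) -/B.
have cB : char_poly_mx B =
    map_mx polyC (invmx P) *m char_poly_mx (diag_mx d) *m map_mx polyC P.
  rewrite /char_poly_mx mulmxBr mulmxBl -!map_mxM -BE scalar_mxC.
  by rewrite -mulmxA -map_mxM mulVmx // map_mx1 mulmx1.
have -> : char_poly B = char_poly (diag_mx d).
  rewrite /char_poly cB !det_mulmx mulrC mulrA -det_mulmx -map_mxM mulmxV //.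
  by rewrite map_mx1 det1 mul1r.
rewrite char_poly_trig ?diag_mx_is_trig // rmorph_prod /s big_map big_enum /=.
apply: eq_bigr => i _; rewrite rmorphB /= map_polyX map_polyC /= mxE eqxx mulr1n.
by have /complex_realP[r ->] := dR 0 i.
Qed.

Lemma char_poly_eigenvalues (R : rcfType) n (A : 'M[R]_n) : A^T = A ->
  char_poly A = \prod_(x <- eigenvalues A) ('X - x%:P).
Proof.
move=> /symmetric_char_poly_split[s pE]; rewrite pE; apply: perm_big.
rewrite perm_sym perm_sort; apply/allP => x _ /=; apply/eqP.
have p0 : char_poly A != 0 by rewrite monic_neq0 ?char_poly_monic.
rewrite count_flatten -map_comp.
have -> : count_mem x s = mup x (char_poly A) by rewrite pE mu_prod_XsubC.
have rP := roots_on_rootsR p0.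
have uR : uniq (rootsR (char_poly A)) by apply: uniq_roots.
rewrite sumnE big_map /=.
under eq_bigr => y _ do rewrite count_nseq /=.
have [xr|xr] := boolP (x \in rootsR (char_poly A)).
  rewrite (bigD1_seq x) //= eqxx mul1n big1 ?addn0 // => y /negPf yx.
  by rewrite yx mul0n.
have px : ~~ root (char_poly A) x.
  by apply: contra xr => px; rewrite -rP in_itv.
rewrite big1_seq ?mupNroot // => y /= yr; case: eqP => [yx|]; last by rewrite mul0n.
by rewrite -yx yr in xr.
Qed.

Lemma size_eigenvalues (R : rcfType) n (A : 'M[R]_n) : A^T = A ->
  size (eigenvalues A) = n.
Proof.
move=> /char_poly_eigenvalues pE; apply/eqP; rewrite -eqSS -(size_char_poly A).
by rewrite pE size_prod_XsubC.
Qed.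

Lemma trmx_Aalpha (R : nzRingType) (G : sgraph) (alpha : R) :
  (Aalpha G alpha)^T = Aalpha G alpha.
Proof.
rewrite /Aalpha linearD !linearZ /= tr_diag_mx; congr (_ + _ *: _).
by apply/matrixP => i j; rewrite !mxE adj_sym.
Qed.

(* Main.v *)
Require Import Defs.
From mathcomp Require Import all_boot all_order all_algebra.
From mathcomp Require Import complex.
From mathcomp Require Import reals ring lra.
Set Implicit Arguments.
Unset Strict Implicit.
Unset Printing Implicit Defensive.
Import Order.TTheory GRing.Theory Num.Theory.
Local Open Scope ring_scope.
Local Open Scope complex_scope.
Local Open Scope sesquilinear_scope.

(** Write t = alpha n - 1. Since A_alpha(K_n) = t I + (1 - alpha) J, the form of
    A_alpha(G) - t I at y is (1 - alpha) |sum y|^2 minus the form of A_alpha of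
    the complement of G. For alpha > 1/2 the latter is nonnegative, and it
    vanishes exactly when y is supported on the set S of vertices of degree
    n - 1. So on the hyperplane sum y = 0 the form is nonpositive, which gives
    lambda_2 <= t by min-max, while it is nonnegative on the vectors supported
    on S, which gives lambda_|S| >= t. If conversely lambda_k = t, the form is
    nonnegative on a space of dimension k; its part in the hyperplane, of
    dimension at least k - 1 > 0, consists of vectors supported on S with sum
    zero, so that k - 1 <= |S| - 1.

    The min-max argument is carried out over R[i], where the spectral theorem
    is available. *)

(** * Counting in sorted lists, and kernels by dimension *)

(** In a nonincreasing list the elements of an upward closed predicate form a prefix, of length
    [count a s]. *)
Lemma sorted_nth_count (d : Order.disp_t) (T : porderType d) (x0 : T)
    (a : pred T) (s : seq T) k :
  {homo a : x y / (x <= y)%O >-> x ==> y} -> sorted >=%O s ->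
  (k < size s)%N -> a (nth x0 s k) = (k < count a s)%N.
Proof.
move=> a_up; elim: s k => [//|x s IHs] k xs ks.
have s_sorted : sorted >=%O s by apply: path_sorted xs.
rewrite /=; have [ax|nax] := boolP (a x).
  by case: k ks => [|k] ks /=; rewrite ?ax // IHs.
have x_max : all (<= x)%O s.
  by apply: order_path_min xs => // u v w vu wv; apply: le_trans wv vu.
have all_na y : y \in s -> ~~ a y.
  move=> /(allP x_max) yx; apply: contra nax; exact: (implyP (a_up _ _ yx)).
have -> : count a s = 0%N.
  by apply/eqP; rewrite -leqn0 leqNgt -has_count; apply/hasPn.
case: k ks => [|k] ks /=; first exact: negPf.
by rewrite (negPf (all_na _ (mem_nth _ _))).
Qed.

(** Dimension count: [p] linear conditions, the columns of [M], cannot cut a space of dimension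
    [m > p] down to zero. *)
Lemma exists_row_kernel (F : fieldType) m n p (U : 'M[F]_(m, n))
    (M : 'M[F]_(n, p)) :
  row_free U -> (p < m)%N ->
  exists2 y : 'rV_n, y != 0 & (y <= U)%MS /\ y *m M = 0.
Proof.
move=> Ufree pm; have : kermx (U *m M) != 0.
  rewrite kermx_eq0 -row_leq_rank -ltnNge.
  by apply: leq_ltn_trans pm; apply: rank_leq_col.
case/rowV0Pn=> z /sub_kermxP zUM z0; exists (z *m U).
  by rewrite mulmx_free_eq0.
by rewrite submxMl -mulmxA.
Qed.

(** * Hermitian forms and the spectral theorem *)

Definition hform (C : numClosedFieldType) n (A : 'M[C]_n) (y : 'rV[C]_n) : C :=
  (y *m A *m y^t*) 0 0.

Lemma hformE (C : numClosedFieldType) n (A : 'M[C]_n) y :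
  hform A y = \sum_i \sum_j A i j * (y 0 i * (y 0 j)^*).
Proof.
rewrite /hform mxE exchange_big /=; apply: eq_bigr => j _.
by rewrite !mxE mulr_suml; apply: eq_bigr => i _; rewrite mulrCA mulrA.
Qed.

Lemma hform_congr (C : numClosedFieldType) n (P B : 'M[C]_n) (y : 'rV_n) :
  hform (P^t* *m B *m P) y = hform B (y *m P^t*).
Proof. by rewrite /hform !trmx_mul !map_mxM /= trmxCK !mulmxA. Qed.

Lemma hform_diag (C : numClosedFieldType) n (d : 'rV[C]_n) y :
  hform (diag_mx d) y = \sum_i d 0 i * `|y 0 i| ^+ 2.
Proof.
rewrite hformE; apply: eq_bigr => i _; rewrite (bigD1 i) //= big1 => [|j ji].
  by rewrite mxE eqxx addr0 normCK.
by rewrite mxE eq_sym (negPf ji) mul0r.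
Qed.

Lemma char_poly_conj (F : comNzRingType) n (Q B P : 'M[F]_n) :
  Q *m P = 1%:M -> char_poly (Q *m B *m P) = char_poly B.
Proof.
move=> QP; rewrite /char_poly.
have -> : char_poly_mx (Q *m B *m P) =
    map_mx polyC Q *m char_poly_mx B *m map_mx polyC P.
  rewrite /char_poly_mx mulmxBr mulmxBl -!map_mxM; congr (_ - _).
  rewrite scalar_mxC -mulmxA -map_mxM.
  by rewrite QP map_mx1 mulmx1.
by rewrite !det_mulmx mulrAC -det_mulmx -map_mxM QP map_mx1 det1 mul1r.
Qed.

Lemma prod_XsubC_perm_eq (F : fieldType) (s t : seq F) :
  \prod_(x <- s) ('X - x%:P) = \prod_(x <- t) ('X - x%:P) -> perm_eq s t.
Proof.
move=> st; apply/allP => x _ /=.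
by rewrite -!mu_prod_XsubC st.
Qed.

(** Over [R[i]] the matrix is Hermitian, hence unitarily diagonalizable with real diagonal.
    Comparing the linear factors of the characteristic polynomial identifies the diagonal with
    [eigenvalues A] up to order. *)
Lemma symmetric_spectral (R : rcfType) n (A : 'M[R]_n) : A^T = A ->
  exists (P : 'M[R[i]]_n) (d : 'I_n -> R),
    [/\ P \is unitarymx, perm_eq (eigenvalues A) [seq d i | i : 'I_n] &
        map_mx (real_complex R) A = P^t* *m diag_mx (\row_i (d i)%:C) *m P].
Proof.
move=> symA; pose f : {rmorphism R -> R[i]} := real_complex R.
set B := map_mx _ _.
have hB : B \is hermsymmx.
  apply: realsym_hermsym.
    by apply/is_hermitianmxP; rewrite expr0 scale1r map_mx_id // map_trmx symA.
  by apply/mxOverP => i j; rewrite mxE; apply/complex_realP; eexists.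
have uP := spectral_unitarymx B.
have /mxOverP dR := hermitian_spectral_diag_real hB.
have /orthomx_spectralP := hermitian_normalmx hB; rewrite invmx_unitary //.
set P := spectralmx B in uP *; set d := spectral_diag B in dR * => BE.
exists P, (fun i => complex.Re (d 0 i)).
have dE : \row_i (complex.Re (d 0 i))%:C = d.
  by apply/rowP => i; rewrite mxE RRe_real.
split; rewrite ?dE //.
apply/prod_XsubC_perm_eq/(map_poly_inj f).
rewrite -char_poly_eigenvalues // (map_char_poly f) -/B BE.
rewrite char_poly_conj; last first.
  by rewrite -invmx_unitary // mulVmx ?unitarymx_unit.
rewrite char_poly_trig ?diag_mx_is_trig // big_map rmorph_prod big_enum /=.
apply: eq_bigr => i _; rewrite rmorphB /= map_polyX map_polyC /= mxE eqxx mulr1n.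
by rewrite RRe_real.
Qed.

Lemma row_free_rowsub (F : fieldType) m n p (f : 'I_p -> 'I_m)
    (A : 'M[F]_(m, n)) : injective f -> row_free A -> row_free (rowsub f A).
Proof.
move=> f_inj /row_freeP[B AB]; apply/row_freeP; exists (colsub f B).
rewrite mulmx_colsub mul_rowsub_mx AB.
by apply/matrixP => i j; rewrite !mxE (inj_eq f_inj).
Qed.

(** A scalar shift keeps the eigenvectors, so one [P] serves every [t]; [y *m P^t*] lists the
    coordinates of [y] in the eigenbasis. *)
Lemma shifted_spectral (R : rcfType) n (A : 'M[R]_n) : A^T = A ->
  exists (P : 'M[R[i]]_n) (d : 'I_n -> R),
    [/\ P \is unitarymx, perm_eq (eigenvalues A) [seq d i | i : 'I_n] &
        forall t y, hform (map_mx (real_complex R) (A - t%:M)) y =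
          \sum_i (d i - t)%:C * `|(y *m P^t*) 0 i| ^+ 2].
Proof.
move=> /symmetric_spectral[P [d [uP dP AE]]]; exists P, d; split=> // t y.
have tE : map_mx (real_complex R) t%:M = P^t* *m t%:C%:M *m P.
  rewrite scalar_mxC -mulmxA -invmx_unitary // mulVmx ?unitarymx_unit //.
  by rewrite mulmx1 map_scalar_mx.
rewrite map_mxB /= AE tE -mulmxBl -mulmxBr hform_congr.
rewrite -diag_const_mx -linearB hform_diag; apply: eq_bigr => i _.
by rewrite !mxE rmorphB.
Qed.

(** * Min-max for the k-th eigenvalue *)

Lemma lambda_ge_count (R : rcfType) n (A : 'M[R]_n) (a : pred R) k :
  A^T = A -> {homo a : x y / x <= y >-> x ==> y} -> (0 < k <= n)%N ->
  a (lambda k A) = (k <= count a (eigenvalues A))%N.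
Proof.
case: k => // k symA a_up kn; apply: sorted_nth_count => //.
  by apply: sort_sorted => x y; apply: le_total.
by rewrite size_eigenvalues.
Qed.

Lemma count_map_ord (T : Type) n (d : 'I_n -> T) (a : pred T) :
  count a [seq d i | i : 'I_n] = #|[set i | a (d i)]|.
Proof. by rewrite cardsE -sum1_card -sum1_count big_map big_enum_cond. Qed.

(** If fewer than [k] eigenvalues were at least [t], some nonzero vector of [U] would be orthogonal
    to all their eigenvectors, and the form would be negative there. *)
Lemma lambda_ge (R : rcfType) n (A : 'M[R]_n) k m t (U : 'M[R[i]]_(m, n)) :
  A^T = A -> (0 < k <= m)%N -> row_free U ->
  (forall y, (y <= U)%MS -> 0 <= hform (map_mx (real_complex R) (A - t%:M)) y) ->
  t <= lambda k A.
Proof.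
move=> symA /andP[k0 km] Ufree U_ge0.
have kn : (0 < k <= n)%N.
  by rewrite k0 (leq_trans km) // -(eqP Ufree) rank_leq_col.
rewrite (@lambda_ge_count _ _ _ (>= t)) //; last first.
  by move=> x y xy; apply/implyP => /le_trans; apply.
have [P [d [uP /permP dP hE]]] := shifted_spectral symA.
rewrite dP count_map_ord; set I := [set _ | _].
rewrite leqNgt; apply/negP => Ik.
(* The conditions are that the eigenbasis coordinates indexed by [I] vanish. *)
have [y y0 [yU yI]] := exists_row_kernel
  (colsub (enum_val : 'I_#|I| -> 'I_n) (P^t*)) Ufree (leq_trans Ik km).
have := U_ge0 _ yU; rewrite hE; set c := y *m _.
have cI i : i \in I -> c 0 i = 0.
  move=> iI; have /rowP/(_ (enum_rank_in iI i)) := yI.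
  by rewrite mulmx_colsub !mxE enum_rankK_in // => <-; rewrite /c mxE.
have c0 : c != 0.
  by rewrite mulmx_free_eq0 // row_free_unit unitarymx_unit // trmxC_unitary.
have [i ci0] : exists i, c 0 i != 0.
  by apply/rV0Pn.
have term_le0 j : (d j - t)%:C * `|c 0 j| ^+ 2 <= 0.
  have [/cI->|] := boolP (j \in I); first by rewrite normr0 expr0n mulr0.
  rewrite inE /= -ltNge => dt; apply: mulr_le0_ge0; last exact: exprn_ge0.
  by rewrite lecR subr_le0 ltW.
apply/negP; rewrite lt_geF // (bigD1 i) //= ltr_wnDr ?sumr_le0 //.
have: i \notin I by apply: contra ci0 => /cI->.
rewrite inE -ltNge => dt.
by rewrite nmulr_rlt0 ?exprn_gt0 ?normr_gt0 // ltcR subr_lt0.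
Qed.

(** Converse of [lambda_ge]: the space is spanned by the eigenvectors, rows of [P], whose eigenvalue
    is at least [t]. *)
Lemma lambda_le_space (R : rcfType) n (A : 'M[R]_n) k t :
  A^T = A -> (0 < k <= n)%N -> t <= lambda k A ->
  exists m (U : 'M[R[i]]_(m, n)), [/\ (k <= m)%N, row_free U &
    forall y, (y <= U)%MS ->
      0 <= hform (map_mx (real_complex R) (A - t%:M)) y].
Proof.
move=> symA kn; rewrite (@lambda_ge_count _ _ _ (>= t)) //; last first.
  by move=> x y xy; apply/implyP => /le_trans; apply.
have [P [d [uP /permP dP hE]]] := shifted_spectral symA.
rewrite dP count_map_ord; set I := [set _ | _] => Ik.
exists #|I|, (rowsub (enum_val : 'I_#|I| -> 'I_n) P); split=> //.
  apply: row_free_rowsub; first exact: enum_val_inj.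
  by rewrite row_free_unit unitarymx_unit.
move=> _ /submxP[z ->]; rewrite hE sumr_ge0 // => i _.
have [iI|iI] := boolP (i \in I).
  by rewrite mulr_ge0 ?exprn_ge0 // ler0c subr_ge0; move: iI; rewrite inE.
(* The rows of [P] are orthonormal, so the coordinates outside [I] vanish. *)
rewrite -mulmxA mul_rowsub_mx (unitarymxP uP) mxE big1 ?normr0 ?expr0n ?mulr0 //.
move=> j _; rewrite !mxE [_ == i]negbTE ?mulr0 //.
by apply: contra iI => /eqP <-; apply: enum_valP.
Qed.

(** * The form of A_alpha and the complement graph *)

Definition coadj (G : sgraph) (i j : 'I_#|G|) : bool :=
  (i != j) && ~~ adj (enum_val i) (enum_val j).

Lemma coadj_sym (G : sgraph) : symmetric (@coadj G).
Proof. by move=> i j; rewrite /coadj eq_sym adj_sym. Qed.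

Lemma deg_enum_val (G : sgraph) (i : 'I_#|G|) :
  deg (enum_val i) = #|[pred j : 'I_#|G| | adj (enum_val i) (enum_val j)]|.
Proof.
rewrite /deg -[LHS](card_imset _ enum_rank_inj).
apply: eq_card => j; apply/imsetP/idP => [[v + ->]|Aij].
  by rewrite !inE enum_rankK.
by exists (enum_val j); rewrite ?enum_valK // inE.
Qed.

(* coadj is the adjacency of the complement of G. Both sides are doubled because
   the pairs (i, j) and (j, i) have to be grouped for the squares to appear. *)
Lemma Aalpha_form (R : rcfType) (G : sgraph) (alpha s : R)
    (y : 'rV[R[i]]_#|G|) :
  2 * hform (map_mx (real_complex R) (Aalpha G alpha - s%:M)) y =
  2 * ((alpha * #|G|%:R - 1 - s)%:C * \sum_i `|y 0 i| ^+ 2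
       + (1 - alpha)%:C * `|\sum_i y 0 i| ^+ 2)
  - \sum_i \sum_(j | coadj i j)
      ((2 * alpha - 1)%:C * (`|y 0 i| ^+ 2 + `|y 0 j| ^+ 2)
       + (1 - alpha)%:C * `|y 0 i + y 0 j| ^+ 2).
Proof.
pose A (i j : 'I_#|G|) := adj (enum_val i) (enum_val j).
(* The degree term at [i] is spread evenly over the neighbours of [i], so that the form is a sum of
   [X] over adjacent ordered pairs, up to the shift by [s]. *)
pose X i j :=
  alpha%:C * (y 0 i * (y 0 i)^*) + (1 - alpha)%:C * (y 0 i * (y 0 j)^*).
have formE : hform (map_mx (real_complex R) (Aalpha G alpha - s%:M)) y =
    \sum_i \sum_(j | A i j) X i j - s%:C * \sum_i `|y 0 i| ^+ 2.
  rewrite hformE mulr_sumr -sumrB; apply: eq_bigr => i _.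
  transitivity (\sum_j
     (((i == j)%:R * (alpha * (deg (enum_val i))%:R - s))%:C
         * (y 0 i * (y 0 j)^*)
      + (A i j)%:R * ((1 - alpha)%:C * (y 0 i * (y 0 j)^*)))).
    apply: eq_bigr => j _; rewrite !mxE [(A i j)%:R * _]mulrA -mulrDl; congr (_ * _).
    rewrite -(rmorph_nat (real_complex R)) -rmorphM -rmorphD /=.
    by congr (_%:C); rewrite -/(A i j); case: (i == j); rewrite /=; ring.
  rewrite big_split /= (bigD1 i) //= big1 => [|j]; last first.
    by rewrite eq_sym => /negPf ->; rewrite mul0r rmorph0 mul0r.
  have -> : \sum_j (A i j)%:R * ((1 - alpha)%:C * (y 0 i * (y 0 j)^*)) =
      \sum_(j | A i j) (1 - alpha)%:C * (y 0 i * (y 0 j)^*).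
    rewrite [RHS]big_mkcond; apply: eq_bigr => j _.
    by case: (A i j); rewrite ?mul1r ?mul0r.
  rewrite eqxx mul1r addr0 big_split /= sumr_const -deg_enum_val normCK.
  rewrite rmorphB rmorphM rmorph_nat -[in RHS]mulr_natr; ring.
(* Adjacent pairs are all pairs minus the diagonal and the pairs adjacent in the complement. *)
have splitE : \sum_i \sum_(j | A i j) X i j =
    \sum_i \sum_j X i j - \sum_i X i i - \sum_i \sum_(j | coadj i j) X i j.
  rewrite -!sumrB; apply: eq_bigr => i _.
  rewrite [\sum_j X i j](bigD1 i) //= [X i i + _]addrC addrK.
  rewrite [\sum_(j | j != i) _](bigID (A i)) /=.
  rewrite [X in _ + X - _](eq_bigl (coadj i)) => [|j]; last first.
    by rewrite /coadj eq_sym.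
  rewrite addrK; apply: eq_bigl => j; rewrite andb_idl // => Aij.
  by apply: contraTneq Aij => ->; rewrite /A adj_irrefl.
(* In [X i j + X j i] the cross terms complete to (1 - alpha) |y_i + y_j|^2, which leaves alpha - (1
   - alpha) = 2 alpha - 1 on the squares. *)
have symE : 2 * (\sum_i \sum_(j | coadj i j) X i j) =
    \sum_i \sum_(j | coadj i j)
      ((2 * alpha - 1)%:C * (`|y 0 i| ^+ 2 + `|y 0 j| ^+ 2)
       + (1 - alpha)%:C * `|y 0 i + y 0 j| ^+ 2).
  have swap : \sum_i \sum_(j | coadj i j) X i j =
      \sum_i \sum_(j | coadj i j) X j i.
    rewrite (exchange_big_dep xpredT) //=; apply: eq_bigr => i _.
    by apply: eq_bigl => j; rewrite coadj_sym.
  rewrite mulr_natl mulr2n {2}swap -big_split; apply: eq_bigr => i _ /=.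
  rewrite -big_split; apply: eq_bigr => j _ /=.
  rewrite /X !normCK rmorphD !(rmorphB, rmorphM, rmorph1, rmorph_nat) /=; ring.
have allE : \sum_i \sum_j X i j =
    (alpha * #|G|%:R)%:C * (\sum_i `|y 0 i| ^+ 2)
    + (1 - alpha)%:C * `|\sum_i y 0 i| ^+ 2.
  rewrite normCK rmorph_sum mulr_suml !mulr_sumr -big_split.
  apply: eq_bigr => i _ /=; rewrite big_split /= sumr_const card_ord.
  rewrite !mulr_sumr normCK rmorphM rmorph_nat -mulr_natr; ring.
have diagE : \sum_i X i i = \sum_i `|y 0 i| ^+ 2.
  apply: eq_bigr => i _; rewrite /X -mulrDl -rmorphD /= addrC subrK mul1r.
  by rewrite normCK.
rewrite formE splitE mulrBr mulrBr symE allE diagE.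
by rewrite !(rmorphB, rmorphM, rmorph1, rmorph_nat) /=; ring.
Qed.

(** The neighbours of [i] lie among the n - 1 other vertices, and equal cardinality means equality
    of the two sets. *)
Lemma deg_max_coadj (G : sgraph) (i : 'I_#|G|) :
  (deg (enum_val i) == #|G|.-1) = [forall j, ~~ coadj i j].
Proof.
have adj_sub : [pred j | adj (enum_val i) (enum_val j)] \subset predC1 i.
  apply/subsetP => j; rewrite !inE; apply: contraTneq => ->.
  by rewrite adj_irrefl.
have -> : #|G|.-1 = #|predC1 i| by rewrite cardC1 card_ord.
rewrite deg_enum_val.
rewrite (subset_leqif_card adj_sub); apply/subsetP/forallP => [sub j|nco j].
  rewrite negb_and !negbK; have [//|ij] := eqVneq i j.
  by apply: sub; rewrite !inE eq_sym.
rewrite !inE => ji; have := nco j.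
by rewrite /coadj eq_sym ji negbK.
Qed.

(** In [Aalpha_form] the complement terms vanish by the support condition and the norm term by the
    choice of shift; (1 - alpha) |sum y|^2 remains. *)
Lemma Aalpha_form_ge0 (R : rcfType) (G : sgraph) (alpha : R)
    (y : 'rV[R[i]]_#|G|) : alpha <= 1 ->
  (forall i j, coadj i j -> y 0 i = 0) ->
  0 <= hform (map_mx (real_complex R)
                (Aalpha G alpha - (alpha * #|G|%:R - 1)%:M)) y.
Proof.
move=> alpha1 y_supp; rewrite -(pmulr_rge0 _ (ltr0Sn _ 1)) Aalpha_form subrr.
rewrite [X in _ - X]big1 => [|i _]; last first.
  rewrite big1 // => j ij; rewrite (y_supp _ _ ij) (y_supp j i) 1?coadj_sym //.
  by rewrite !(addr0, normr0, expr0n, mulr0).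
by rewrite subr0 mul0r add0r !mulr_ge0 ?exprn_ge0 ?ler0n // ler0c subr_ge0.
Qed.

(** With t = alpha n - 1, sum zero makes twice the form equal to -(2 (s - t) |y|^2 + Q) with Q >= 0,
    so nonnegativity forces both terms to vanish. The case s = t yields the support of [y], the case
    s > t yields [y = 0]. *)
Lemma Aalpha_form_sum0 (R : rcfType) (G : sgraph) (alpha s : R)
    (y : 'rV[R[i]]_#|G|) : 1 / 2 < alpha <= 1 -> alpha * #|G|%:R - 1 <= s ->
  \sum_i y 0 i = 0 ->
  0 <= hform (map_mx (real_complex R) (Aalpha G alpha - s%:M)) y ->
  (forall i j, coadj i j -> y 0 i = 0) /\ (alpha * #|G|%:R - 1 < s -> y = 0).
Proof.
move=> /andP[alpha_gt alpha_le] ts y_sum.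
rewrite -(pmulr_rge0 _ (ltr0Sn _ 1)) Aalpha_form y_sum normr0 expr0n mulr0 addr0.
pose q i j := (2 * alpha - 1)%:C * (`|y 0 i| ^+ 2 + `|y 0 j| ^+ 2)
  + (1 - alpha)%:C * `|y 0 i + y 0 j| ^+ 2.
pose Q := \sum_i \sum_(j | coadj i j) q i j; rewrite -[X in _ - X]/Q.
set N := \sum_i `|y 0 i| ^+ 2.
(* Here alpha > 1/2 enters: a vanishing complement term forces its two entries of [y] to vanish. *)
have a_gt0 : 0 < (2 * alpha - 1)%:C :> R[i] by rewrite ltcR; lra.
have q_ge i j : (2 * alpha - 1)%:C * `|y 0 i| ^+ 2 <= q i j.
  rewrite /q mulrDr -addrA lerDl addr_ge0 ?mulr_ge0 ?exprn_ge0 ?(ltW a_gt0) //.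
  by rewrite ler0c subr_ge0.
have q_ge0 i j : 0 <= q i j.
  by apply: le_trans (q_ge i j); rewrite mulr_ge0 ?exprn_ge0 ?(ltW a_gt0).
have row_ge0 i : 0 <= \sum_(j | coadj i j) q i j by apply: sumr_ge0.
have Q_ge0 : 0 <= Q by apply: sumr_ge0.
have N_ge0 : 0 <= N by apply: sumr_ge0 => i _; apply: exprn_ge0.
have sN_ge0 : 0 <= (s - (alpha * #|G|%:R - 1))%:C * N.
  by rewrite mulr_ge0 // ler0c subr_ge0.
rewrite -[_ - 1 - s]opprB rmorphN mulNr mulrN -opprD oppr_ge0 => sum_le0.
have : 2 * ((s - (alpha * #|G|%:R - 1))%:C * N) + Q == 0.
  by rewrite eq_le sum_le0 addr_ge0 // mulr_ge0.
rewrite paddr_eq0 ?(mulr_ge0 _ sN_ge0) // mulf_eq0 pnatr_eq0 /= => /andP[sN0 /eqP Q0].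
split=> [i j ij|ts'].
  have row0 : \sum_(j | coadj i j) q i j = 0.
    by apply: (psumr_eq0P _ Q0) => // l _; apply: row_ge0.
  have q0 : q i j = 0 by apply: (psumr_eq0P _ row0) => // l _; apply: q_ge0.
  apply/eqP; have := q_ge i j; rewrite q0 pmulr_rle0 // => y_le0.
  by rewrite -normr_eq0 -sqrf_eq0 eq_le y_le0 exprn_ge0.
move: sN0; rewrite mulf_eq0 gt_eqF ?ltcR ?subr_gt0 //= => /eqP N0.
apply/rowP => i; rewrite mxE; apply/eqP.
rewrite -normr_eq0 -sqrf_eq0; apply/eqP.
by apply: (psumr_eq0P _ N0) => // l _; apply: exprn_ge0.
Qed.

(** * The equivalence *)

Theorem theorem1p2 (R : realType) (G : sgraph) (n : nat) (alpha : R) (k : nat)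
    (hn : #|G| = n) (halpha : 1 / 2 < alpha <= 1) (hk : (2 <= k <= n)%N) :
  lambda k (Aalpha G alpha) = alpha * n%:R - 1
  <-> (k <= #|[set v : G | deg v == n.-1]|)%N.
Proof.
move: hk => /andP[k2 kn]; have k0 : (0 < k)%N by apply: leq_trans k2.
have k0n : (0 < k <= n)%N by rewrite k0.
subst n; set t := alpha * _ - 1.
pose S := [set i : 'I_#|G| | deg (enum_val i) == #|G|.-1].
have -> : #|[set v : G | deg v == #|G|.-1]| = #|S|.
  rewrite -[RHS](card_imset _ enum_val_inj); apply: eq_card => v.
  rewrite inE; apply/idP/imsetP => [dv|[i + ->]]; last by rewrite inE.
  by exists (enum_rank v); rewrite ?enum_rankK // inE enum_rankK.
have symA := trmx_Aalpha G alpha.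
have notinS i : i \notin S -> exists j, coadj i j.
  by rewrite inE deg_max_coadj negb_forall => /existsP[j /negPn]; exists j.
have inS i j : coadj i j -> i \notin S.
  move=> ij; rewrite inE deg_max_coadj negb_forall; apply/existsP.
  by exists j; rewrite negbK.
have sum0 (y : 'rV[R[i]]_#|G|) :
    y *m (const_mx 1 : 'M_(_, 1)) = 0 -> \sum_i y 0 i = 0.
  move=> /matrixP/(_ 0 0); rewrite !mxE => {2}<-.
  by apply: eq_bigr => i _; rewrite mxE mulr1.
split=> [lambdaE|kS].
  rewrite leqNgt; apply/negP => Sk.
  have t_le : t <= lambda k (Aalpha G alpha) by rewrite lambdaE.
  have [m [U [km Ufree U_ge0]]] := lambda_le_space symA k0n t_le.
  (* S' is S with one vertex removed, if S is not empty: a vector supported on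
     S, zero on S' and with sum zero is zero. *)
  have [S' S'k S'_uniq] : exists2 S' : {set 'I_#|G|}, (#|S'|.+1 < k)%N &
      {in S :\: S' &, forall i j, i = j}.
    have [->|[i0 i0S]] := set_0Vmem S.
      (* For empty [S] the bound is 1 < k, that is, the hypothesis on [k]. *)
      by exists set0 => [|i j]; rewrite ?cards0 // !inE.
    exists (S :\ i0); first by move: Sk; rewrite (cardsD1 i0 S) i0S.
    have only i : i \in S :\: (S :\ i0) -> i = i0.
      rewrite in_setD in_setD1 => /andP[+ iS].
      by rewrite iS andbT negbK => /eqP.
    by move=> i j /only-> /only->.
  (* Sum zero and vanishing on [S'] are [#|S'|.+1 < k <= m] conditions on [U]. *)
  have [y y0 [yU]] := exists_row_kernel (row_mx (const_mx 1 : 'M_(_, 1))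
    (colsub (enum_val : 'I_#|S'| -> 'I_#|G|) 1%:M)) Ufree (leq_trans S'k km).
  rewrite mul_mx_row => /eqP; rewrite row_mx_eq0 => /andP[/eqP y1 /eqP yS'].
  have y_sum := sum0 _ y1.
  have [y_supp _] := Aalpha_form_sum0 halpha (lexx t) y_sum (U_ge0 _ yU).
  have yNS i : i \notin S -> y 0 i = 0 by move=> /notinS[j /y_supp].
  have yS'0 i : i \in S' -> y 0 i = 0.
    move=> iS'; have /rowP/(_ (enum_rank_in iS' i)) := yS'.
    by rewrite mulmx_colsub mulmx1 !mxE enum_rankK_in.
  have y_in i : y 0 i != 0 -> i \in S :\: S'.
    move=> yi; rewrite in_setD; apply/andP; split.
      by apply: contraNN yi => /yS'0 ->.
    by apply: contraNT yi => /yNS ->.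
  have /rV0Pn[i yi] := y0; move/eqP: y_sum; apply/negP.
  rewrite (bigD1 i) //= big1 ?addr0 // => j ji.
  apply/eqP; apply: contraNT ji => yj.
  by apply/eqP/S'_uniq; apply: y_in.
apply/eqP; rewrite eq_le; apply/andP; split.
  rewrite leNgt; apply/negP => t_lt.
  (* The shift is lambda_k itself, assumed greater than t; the space has dimension at least 2, so it
     meets the hyperplane of sum zero nontrivially. *)
  have [m [U [km Ufree U_ge0]]] := lambda_le_space symA k0n (lexx _).
  have [y /eqP y0 [yU y1]] :=
    exists_row_kernel (const_mx 1 : 'M_(_, 1)) Ufree (leq_trans k2 km).
  have y_sum := sum0 _ y1.
  have [_ /(_ t_lt)] := Aalpha_form_sum0 halpha (ltW t_lt) y_sum (U_ge0 _ yU).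
  exact: y0.
(* The unit vectors at the vertices of [S] span a space of dimension [#|S| >= k] on which the form
   is nonnegative. *)
apply: (lambda_ge (m := #|S|)
  (U := rowsub (enum_val : 'I_#|S| -> 'I_#|G|) 1%:M)) => //.
- by rewrite k0.
- by apply: row_free_rowsub; [exact: enum_val_inj | rewrite row_free_unit unitmx1].
move=> _ /submxP[z ->]; apply: Aalpha_form_ge0 => [|i j /inS iS].
  by case/andP: halpha.
rewrite mxE big1 // => l _; rewrite !mxE [_ == i]negbTE ?mulr0 //.
by apply: contra iS => /eqP <-; apply: enum_valP.
Qed.
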